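(* Let $G=(V,E,w)$ be a finite connected graph with $|V|=n\ge2$, weights $w:E\to\mathbb{R}_{>0}$ and total weight $W=\sum_{e\in E}w_e$. Fix $\alpha\in(0,1/2]$ and put $N=n-1$, $q=1-\alpha$, $J=\lfloor\log_{1/q}N\rfloor$. If $\kappa_j(G,w;\alpha)<\infty$ for every $j\in\{0,\ldots,J\}$, then there exists a connected binary hierarchy $T$ on $V$ such that $$\operatorname{cost}_D^-(T)\le W\sum_{j=0}^{J}\kappa_j(G,w;\alpha).$$ Consequently, $$\frac{\operatorname{OPT}_{\mathrm{card}}(G,w)}{\operatorname{OPT}_{\mathrm{free}}(G,w)}\le\sum_{j=0}^{J}\kappa_j(G,w;\alpha).$$
   Context: Fragmentation profile. For $S\subseteq V$ with $G[S]$ connected, $W(S)=\sum_{xy\in E(G[S])}w_{xy}$; for disjoint $A,B\subseteq V$, $w(A,B)$ is the total weight of edges with one endpoint in $A$ and the other in $B$. A connected $\alpha$-balanced fragmentation of $S$ is a bipartition $S=A\mathbin{\dot\cup}B$ with $G[A],G[B]$ connected (nonempty) and $\max\{|A|-1,|B|-1\}\le(1-\alpha)(|S|-1)$. For connected $S$ with $|S|\ge2$, $\operatorname{frag}_\alpha(S)$ is the minimum of $(|S|-1)w(A,B)/W(S)$ over all connected $\alpha$-balanced fragmentations of $S$, and $+\infty$ if there are none. For $j\in\{0,\ldots,J\}$, $\kappa_j(G,w;\alpha)=\sup\{\operatorname{frag}_\alpha(S): S\subseteq V,\ G[S]\text{ connected},\ q^{j+1}N<|S|-1\le q^jN\}$,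 with the supremum over an empty family equal to $0$. Hierarchies and optima. A rooted binary hierarchy $T$ on $V$ is a rooted tree whose leaves are the vertices of $V$ and whose internal nodes have exactly two children; each node is identified with the set of leaves below it (a cluster), and $C_T(x,y)$ is the cluster of the lowest common ancestor of $x,y$. $T$ is connected if every cluster induces a connected subgraph of $G$. $\operatorname{cost}_D^-(T)=\sum_{xy\in E}w_{xy}(|C_T(x,y)|-1)$. $d_G$ is the shortest-path metric of $(V,E)$ with every edge of length $1$. $\operatorname{OPT}_{\mathrm{free}}(G,w)$ is the minimum of $\sum_{xy\in E}w_{xy}u(x,y)$ over all ultrametrics $u$ on $V$ (metrics with $u(x,y)\le\max\{u(x,z),u(z,y)\}$) with $u\ge d_G$ on all pairs. Put $h_H(x,x)=0$, $h_H(x,y)=|C_H(x,y)|-1$ for $x\ne y$; $\operatorname{OPT}_{\mathrm{card}}(G,w)$ is the minimum of $\sum_{xy\in E}w_{xy}h_H(x,y)$ over all rooted binary hierarchies $H$ on $V$ with $h_H\ge d_G$ on all pairs. *)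

(* Defs.v *)
From HB Require Import structures.
From mathcomp Require Import all_boot all_order all_algebra.
From mathcomp Require Import boolp classical_sets reals ereal exp.

Set Implicit Arguments.
Unset Strict Implicit.
Unset Printing Implicit Defensive.

Import Order.TTheory GRing.Theory Num.Theory.
Local Open Scope ring_scope.

(* [weight] is only meaningful on edges: every definition below reads it on
   adjacent pairs only. *)
Record wgraph (R : realType) (V : finType) := WGraph {
  adj : rel V;
  weight : V -> V -> R;
  adj_sym : symmetric adj;
  adj_irr : irreflexive adj;
  weight_sym : forall x y, adj x y -> weight x y = weight y x;
  weight_gt0 : forall x y, adj x y -> 0 < weight x y }.

Section Graphs.
Context {R : realType} {V : finType}.
Variable G : wgraph R V.
Implicit Types (S A B : {set V}) (x y : V) (alpha : R) (j : nat).

Definition connected_set S : bool :=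
  (S != finset.set0) &&
  [forall x in S, forall y in S,
    connect [rel a b | [&& a \in S, b \in S & adj G a b]] x y].

Definition connected_graph : bool := connected_set [set: V].

(* The least length of a walk from x to y; in a connected graph a shortest walk
   has length < #|V|, so the default value #|V| is never reached there. *)
Definition gdist x y : nat :=
  \big[minn/#|V|]_(k < #|V| |
     [exists p : k.-tuple V, path (adj G) x p && (last x p == y)]) k.

(* Sum of f over the edges of G[S], for f symmetric on edges: the double sum
   meets each edge in both orientations. *)
Definition edge_sum S (f : V -> V -> R) : R :=
  (\sum_(x in S) \sum_(y in S | adj G x y) f x y) / 2.

Definition weight_in S : R := edge_sum S (weight G).

Definition total_weight : R := weight_in [set: V].

(* w(A, B), for A and B disjoint. *)
Definition weight_between A B : R :=
  \sum_(x in A) \sum_(y in B | adj G x y) weight G x y.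

Definition fragmentation alpha S A B : bool :=
  [&& A :|: B == S, [disjoint A & B], connected_set A, connected_set B &
      (maxn #|A|.-1 #|B|.-1)%:R <= (1 - alpha) * #|S|.-1%:R].

Definition frag alpha S : \bar R :=
  \big[Order.min/+oo%E]_(AB : {set V} * {set V}
                         | fragmentation alpha S AB.1 AB.2)
     (#|S|.-1%:R * weight_between AB.1 AB.2 / weight_in S)%:E.

(* As frag is nonnegative, the base value 0 matters for the empty family only. *)
Definition kappa alpha j : \bar R :=
  let N : R := #|V|.-1%:R in let q := 1 - alpha in
  \big[Order.max/0%E]_(S : {set V} | connected_set S &&
      (q ^+ j.+1 * N < #|S|.-1%:R <= q ^+ j * N)) frag alpha S.

End Graphs.

(* floor (log_{1/q} N) with q = 1 - alpha and N = #|V| - 1; for #|V| >= 2 and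
   0 < alpha < 1 the logarithm is nonnegative, and truncn is its floor. *)
Definition top_level (R : realType) (V : finType) (alpha : R) : nat :=
  Num.truncn (ln #|V|.-1%:R / ln (1 - alpha)^-1).

Inductive btree (V : Type) := Leaf of V | Node of btree V & btree V.

Section Hierarchies.
Context {V : finType}.
Implicit Types (T : btree V) (x y : V).

Fixpoint leaves T : seq V :=
  match T with
  | Leaf v => [:: v]
  | Node l r => leaves l ++ leaves r
  end.

Definition is_hierarchy T : bool := perm_eq (leaves T) (enum V).

Fixpoint clusters T : seq {set V} :=
  [set x in leaves T] ::
  match T with
  | Leaf _ => [::]
  | Node l r => clusters l ++ clusters r
  end.

(* C_T(x, y), for x and y leaves of T: descend while x and y lie below the same
   child. *)
Fixpoint lca_cluster T x y : {set V} :=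
  match T with
  | Leaf v => [set v]
  | Node l r =>
      if (x \in leaves l) && (y \in leaves l) then lca_cluster l x y
      else if (x \in leaves r) && (y \in leaves r) then lca_cluster r x y
      else [set z in leaves l ++ leaves r]
  end.

Definition height T x y : nat :=
  if x == y then 0%N else #|lca_cluster T x y|.-1.

End Hierarchies.

Section Optima.
Context {R : realType} {V : finType}.
Variable G : wgraph R V.

Definition connected_hierarchy (T : btree V) : bool :=
  is_hierarchy T && all (connected_set G) (clusters T).

Definition cost (T : btree V) : R :=
  edge_sum G [set: V]
    (fun x y => weight G x y * #|lca_cluster T x y|.-1%:R).

Definition ultrametric (u : V -> V -> R) : Prop :=
  [/\ forall x y, 0 <= u x y,
      forall x y, u x y = 0 <-> x = y,
      forall x y, u x y = u y x &
      forall x y z, u x y <= Num.max (u x z) (u z y)].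

(* Both feasible sets below are nonempty when G is connected, and both infima
   are then attained (u may be replaced by the integer-valued ultrametric
   min(floor u, #|V|) without increasing its cost). *)
Definition OPT_free : R :=
  inf [set c | exists u : V -> V -> R,
    [/\ ultrametric u,
        forall x y, (gdist G x y)%:R <= u x y &
        c = edge_sum G [set: V] (fun x y => weight G x y * u x y)]]%classic.

Definition OPT_card : R :=
  inf [set c | exists H : btree V,
    [/\ is_hierarchy H,
        forall x y, (gdist G x y <= height H x y)%N &
        c = edge_sum G [set: V]
              (fun x y => weight G x y * (height H x y)%:R)]]%classic.

End Optima.

(* Main.v *)
Require Import Defs.
From HB Require Import structures.
From mathcomp Require Import all_boot all_order all_algebra.
From mathcomp Require Import boolp classical_sets reals ereal exp.
From mathcomp Require Import lra.

Set Implicit Arguments.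
Unset Strict Implicit.
Unset Printing Implicit Defensive.

Import Order.TTheory GRing.Theory Num.Theory.
Local Open Scope ring_scope.

(* Split every cluster S along an optimal balanced fragmentation.  If S lies at
   scale j, this costs (|S| - 1) w(A, B) <= kappa_j W(S), and by balance both
   parts lie at scale j + 1 or beyond.  Since W(A) + W(B) <= W(S), each scale
   contributes at most kappa_j W in total.  In a connected hierarchy the height
   of a pair dominates its graph distance, and an ultrametric dominating the
   graph distance costs at least W. *)

(** * Additivity of edge sums over a bipartition *)

Section EdgeSums.
Context {R : realType} {V : finType}.
Variable G : wgraph R V.
Implicit Types (S A B : {set V}) (f g : V -> V -> R).

Lemma eq_edge_sum S f g :
  (forall x y, x \in S -> y \in S -> adj G x y -> f x y = g x y) ->
  edge_sum G S f = edge_sum G S g.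
Proof.
move=> eq_fg; congr (_ / _); apply: eq_bigr => x xS.
by apply: eq_bigr => y /andP[yS xy]; apply: eq_fg.
Qed.

Lemma ler_edge_sum S f g :
  (forall x y, x \in S -> y \in S -> adj G x y -> f x y <= g x y) ->
  edge_sum G S f <= edge_sum G S g.
Proof.
move=> le_fg; rewrite ler_pM2r ?invr_gt0 ?ltr0n//; apply: ler_sum => x xS.
by apply: ler_sum => y /andP[yS xy]; apply: le_fg.
Qed.

Lemma edge_sum_ge0 S f :
  (forall x y, x \in S -> y \in S -> adj G x y -> 0 <= f x y) ->
  0 <= edge_sum G S f.
Proof.
move=> f0; apply: divr_ge0 => //; apply: sumr_ge0 => x xS.
by apply: sumr_ge0 => y /andP[yS xy]; apply: f0.
Qed.

Lemma edge_sumU A B f : [disjoint A & B] ->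
  (forall x y, x \in A -> y \in B -> adj G x y -> f x y = f y x) ->
  edge_sum G (A :|: B) f = edge_sum G A f + edge_sum G B f
    + \sum_(x in A) \sum_(y in B | adj G x y) f x y.
Proof.
move=> dAB symf.
have splitU (F : V -> R) :
    \sum_(x in A :|: B) F x = \sum_(x in A) F x + \sum_(x in B) F x.
  by rewrite -bigU//=; apply: eq_bigl => x; rewrite !inE.
have splitUadj x : \sum_(y in A :|: B | adj G x y) f x y =
    \sum_(y in A | adj G x y) f x y + \sum_(y in B | adj G x y) f x y.
  by rewrite 3!big_mkcondr /= splitU.
rewrite /edge_sum splitU; under eq_bigr do rewrite splitUadj.
under [X in _ + X]eq_bigr do rewrite splitUadj.
rewrite !big_split /=.
(* The two orientations of the crossing edges give equal sums, which absorbs the division by 2 in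
   [edge_sum]. *)
have -> : \sum_(x in B) \sum_(y in A | adj G x y) f x y =
          \sum_(x in A) \sum_(y in B | adj G x y) f x y.
  under eq_bigr do rewrite big_mkcondr /=.
  under [RHS]eq_bigr do rewrite big_mkcondr /=.
  rewrite exchange_big /=; apply: eq_bigr => x xA; apply: eq_bigr => y yB.
  by rewrite (adj_sym G y x); case: ifP => // xy; rewrite (symf x y).
lra.
Qed.

Lemma weight_in_ge0 S : 0 <= weight_in G S.
Proof. by apply: edge_sum_ge0 => x y _ _ /weight_gt0/ltW. Qed.

Lemma weight_between_ge0 A B : 0 <= weight_between G A B.
Proof.
apply: sumr_ge0 => x _; apply: sumr_ge0 => y /andP[_].
by move=> /weight_gt0/ltW.
Qed.

Lemma weight_inU A B : [disjoint A & B] ->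
  weight_in G (A :|: B) = weight_in G A + weight_in G B + weight_between G A B.
Proof.
by move=> dAB; apply: edge_sumU => // x y _ _; apply: weight_sym.
Qed.

End EdgeSums.

(** * Graph distance inside connected sets *)

Section Distance.
Context {R : realType} {V : finType}.
Variable G : wgraph R V.
Implicit Types (S : {set V}) (x y : V).

Lemma gdist_le_path x p : (size p < #|V|)%N -> path (adj G) x p ->
  (gdist G x (last x p) <= size p)%N.
Proof.
move=> ltpV xp; rewrite /gdist -leEnat.
apply: (@bigmin_le_cond _ _ _ _ (Ordinal ltpV) _ (fun k => val k)).
by apply/existsP; exists (in_tuple p); rewrite /= xp eqxx.
Qed.

Lemma gdistxx x : gdist G x x = 0%N.
Proof.
apply/eqP; rewrite -leqn0; apply: (@gdist_le_path x [::]) => //.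
by apply/card_gt0P; exists x.
Qed.

(** The default [#|V|] of the minimum is positive, and a walk of length 0 would make [x] adjacent to
    itself. *)
Lemma gdist_adj x y : adj G x y -> (0 < gdist G x y)%N.
Proof.
move=> xy; rewrite /gdist.
apply: (big_ind (fun m => 0 < m)%N) => [|m n m0 n0|[[|k] ltk] //].
- by apply/card_gt0P; exists x.
- by rewrite leq_min m0.
- case/existsP=> p; rewrite (tuple0 p) /= => /eqP exy.
  by move: xy; rewrite exy adj_irr.
Qed.

(** A walk inside [S], shortened to a repetition-free one, visits at most [#|S|] vertices. It is
    thus also short enough to be among the walks over which [gdist] minimizes. *)
Lemma gdist_connected_set S x y : connected_set G S -> x \in S -> y \in S ->
  (gdist G x y <= #|S|.-1)%N.
Proof.
case/andP=> _ /forall_inP cS xS yS.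
have /connectP[p xp ->] := forall_inP (cS x xS) y yS.
case/shortenP: xp => {}p xp up _.
have pS : {subset p <= S}.
  elim: p x xp {up xS} => [|z p IHp] x //= /andP[/and3P[_ zS _] zp] v.
  by rewrite inE => /predU1P[->//|]; apply: IHp zp v.
have szp : (size p < #|S|)%N.
  rewrite -[(size p).+1]/(size (x :: p)) -(card_uniqP up).
  apply/subset_leq_card/fintype.subsetP => v.
  by rewrite inE => /predU1P[->//|/pS].
apply: leq_trans (_ : size p <= _)%N; last by rewrite -ltnS (ltn_predK szp).
apply: gdist_le_path; first exact: leq_trans szp (max_card _).
by apply: sub_path xp => a b /and3P[].
Qed.

End Distance.

(** * Lowest common ancestors *)

Section Trees.
Context {V : finType}.
Implicit Types (T : btree V) (x y : V).

Lemma lca_clusterC T x y : lca_cluster T x y = lca_cluster T y x.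
Proof.
by elim: T => //= l -> r ->; rewrite ![(y \in _) && _]andbC.
Qed.

Lemma lca_cluster_in T x y : x \in leaves T -> y \in leaves T ->
  [/\ lca_cluster T x y \in clusters T, x \in lca_cluster T x y &
      y \in lca_cluster T x y].
Proof.
elim: T => [v|l IHl r IHr] /=.
  rewrite !inE => /eqP-> /eqP->; rewrite eqxx; split=> //.
  by apply/eqP/setP=> z; rewrite !inE.
move=> xT yT; case: ifP => [/andP[xl yl]|_].
  have [lcal ? ?] := IHl xl yl.
  by split=> //; rewrite inE mem_cat lcal orbT.
case: ifP => [/andP[xr yr]|_].
  have [lcar ? ?] := IHr xr yr.
  by split=> //; rewrite inE mem_cat lcar !orbT.
by rewrite !inE eqxx.
Qed.

End Trees.

(** * Geometric scales of cluster sizes *)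

Section Levels.
Context {R : realType} {V : finType}.
Variable alpha : R.
Hypothesis halpha : 0 < alpha < 1.

Lemma le_top_level i : 1 <= (1 - alpha) ^+ i * #|V|.-1%:R ->
  (i <= top_level V alpha)%N.
Proof.
case/andP: halpha => a0 a1 h.
have q0 : 0 < 1 - alpha by lra.
have N0 : (0 : R) < #|V|.-1%:R.
  by rewrite -(pmulr_rgt0 _ (exprn_gt0 i q0)) (lt_le_trans ltr01).
have l0 : 0 < ln (1 - alpha)^-1.
  by rewrite ln_gt0// invf_gt1//; lra.
(* Logarithm of (1/q)^i <= N, where q = 1 - [alpha] and N = [#|V|.-1]. *)
have hi : i%:R <= ln #|V|.-1%:R / ln (1 - alpha)^-1.
  rewrite ler_pdivlMr// mulr_natl -lnXn ?invr_gt0//.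
  rewrite ler_ln ?posrE ?exprn_gt0 ?invr_gt0//.
  by rewrite exprVn -[_^-1]mul1r ler_pdivrMr ?exprn_gt0// mulrC.
by rewrite /top_level truncn_ge_nat// (le_trans _ hi).
Qed.

(** The scale is the largest i with s <= q^i N; as s >= 1, [le_top_level] bounds all such i. *)
Lemma exists_level j s : (0 < s)%N -> s%:R <= (1 - alpha) ^+ j * #|V|.-1%:R ->
  exists i, [/\ (j <= i)%N, (i <= top_level V alpha)%N &
    (1 - alpha) ^+ i.+1 * #|V|.-1%:R < s%:R <= (1 - alpha) ^+ i * #|V|.-1%:R].
Proof.
move=> s0 hj; pose P i := s%:R <= (1 - alpha) ^+ i * #|V|.-1%:R.
have Ptop i : P i -> (i <= top_level V alpha)%N.
  by move=> Pi; apply: le_top_level; apply: le_trans Pi; rewrite ler1n.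
have exP : exists i, P i by exists j.
case: (ex_maxnP exP Ptop) => i Pi maxi; exists i.
split; [exact: maxi|exact: Ptop|].
by rewrite -/(P i) Pi andbT ltNge; apply/negP => /maxi; rewrite ltnn.
Qed.

End Levels.

(** * Recursive construction of the hierarchy *)

Section Construction.
Context {R : realType} {V : finType}.
Variables (G : wgraph R V) (alpha : R).
Hypothesis halpha : 0 < alpha < 1.
Hypothesis hkappa : forall j : nat, (j <= top_level V alpha)%N ->
  (kappa G alpha j < +oo)%E.
Implicit Types (S A B : {set V}) (T : btree V).

Lemma kappa_ge0 j : (0 <= kappa G alpha j)%E.
Proof. exact: bigmax_ge_id. Qed.

Lemma fine_kappaK j : (j <= top_level V alpha)%N ->
  (fine (kappa G alpha j))%:E = kappa G alpha j.
Proof. by move=> hj; rewrite fineK// ge0_fin_numE ?kappa_ge0 ?hkappa. Qed.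

Lemma fine_kappa_ge0 j : 0 <= fine (kappa G alpha j).
Proof. by rewrite fine_ge0 ?kappa_ge0. Qed.

Lemma exists_fragmentation i S : (i <= top_level V alpha)%N ->
    connected_set G S ->
    (1 - alpha) ^+ i.+1 * #|V|.-1%:R < #|S|.-1%:R
      <= (1 - alpha) ^+ i * #|V|.-1%:R ->
  exists A B, fragmentation G alpha S A B /\
    #|S|.-1%:R * weight_between G A B <= fine (kappa G alpha i) * weight_in G S.
Proof.
move=> hi cS hS.
have : (frag G alpha S <= (fine (kappa G alpha i))%:E)%E.
  rewrite fine_kappaK// /kappa.
  by apply: (@le_bigmax_cond _ _ _ _ S _ (frag G alpha)); rewrite cS.
(* A minimum below a finite value is not the default [+oo], so some fragmentation attains the
   bound. *)
rewrite /frag => /bigmin_leP[|[[A B] /= fAB]]; first by rewrite leye_eq.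
rewrite lee_fin => le_AB; exists A, B; split=> //.
have [/eqP eAB dAB _ _ _] := and5P fAB.
have := weight_in_ge0 G S; rewrite le0r => /predU1P[WS0|WS0].
  (* the quotient in frag is a junk value here *)
  suff -> : weight_between G A B = 0 by rewrite WS0 !mulr0.
  have := weight_inU G dAB; rewrite eAB WS0.
  have := weight_in_ge0 G A; have := weight_in_ge0 G B.
  by have := weight_between_ge0 G A B; lra.
by rewrite -ler_pdivrMr.
Qed.

(** An edge inside one part keeps its cluster from that subtree, while a crossing edge is first
    joined at the root. *)
Lemma edge_sum_Node l r A B : leaves l =i A -> leaves r =i B ->
    [disjoint A & B] ->
  edge_sum G (A :|: B)
    (fun x y => weight G x y * #|lca_cluster (Node l r) x y|.-1%:R) =
  edge_sum G A (fun x y => weight G x y * #|lca_cluster l x y|.-1%:R) +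
  edge_sum G B (fun x y => weight G x y * #|lca_cluster r x y|.-1%:R) +
  #|A :|: B|.-1%:R * weight_between G A B.
Proof.
move=> lA rB dAB; rewrite edge_sumU//; last first.
  by move=> x y _ _ xy; rewrite weight_sym// lca_clusterC.
congr (_ + _ + _).
- by apply: eq_edge_sum => x y xA yA _; rewrite /= !lA xA yA.
- apply: eq_edge_sum => x y xB yB _; rewrite /= !lA !rB xB yB.
  by rewrite (disjointFl dAB xB).
- rewrite /weight_between mulr_sumr; apply: eq_bigr => x xA.
  rewrite mulr_sumr; apply: eq_bigr => y /andP[yB _].
  rewrite /= !lA !rB (disjointFl dAB yB) (disjointFr dAB xA) andbF /= mulrC.
  suff -> : [set z in leaves l ++ leaves r] = A :|: B by [].
  by apply/setP => z; rewrite !inE mem_cat lA rB.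
Qed.

(** The level [j] is only an upper bound for the size of [S], so that two parts of different sizes
    can be given the same level in the induction on [#|S|]. *)
Lemma exists_connected_tree j S : connected_set G S ->
    #|S|.-1%:R <= (1 - alpha) ^+ j * #|V|.-1%:R ->
  exists T, [/\ uniq (leaves T), leaves T =i S,
    all (connected_set G) (clusters T) &
    edge_sum G S (fun x y => weight G x y * #|lca_cluster T x y|.-1%:R) <=
    weight_in G S *
      \sum_(j <= i < (top_level V alpha).+1) fine (kappa G alpha i)].
Proof.
have [n] := ubnP #|S|; elim: n j S => // n IHn j S leSn cS hS.
have S0 : (0 < #|S|)%N by rewrite card_gt0; case/andP: cS.
have [S1|S_gt1] := leqP #|S| 1.
  have /eqP/cards1P[v defS] : #|S| = 1%N by apply/eqP; rewrite eqn_leq S1.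
  exists (Leaf v); split=> //=.
  - by move=> x; rewrite defS !inE.
  - rewrite andbT; suff -> : [set x in [:: v]] = S by [].
    by apply/setP=> x; rewrite defS !inE.
  - rewrite [X in X <= _](_ : _ = 0).
      rewrite mulr_ge0 ?weight_in_ge0// sumr_ge0// => i _.
      exact: fine_kappa_ge0.
    rewrite (@eq_edge_sum _ _ _ _ _ (fun=> fun=> 0)).
      by rewrite /edge_sum big1 ?mul0r// => x _; rewrite big1.
    by move=> x y _ _ _; rewrite /= cards1 mulr0.
have S1_gt0 : (0 < #|S|.-1)%N by rewrite -ltnS (ltn_predK S_gt1).
(* The exact scale [i] of [S] may exceed [j]: unbalanced progress can skip levels, whose terms in
   the sum are nonnegative. *)
have [i [le_ji le_iJ hi]] := exists_level halpha S1_gt0 hS.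
have [A [B [fAB le_AB]]] := exists_fragmentation le_iJ cS hi.
have [/eqP eAB dAB cA cB balanced] := and5P fAB.
have q0 : 0 <= 1 - alpha by case/andP: halpha; lra.
have le_next m : m%:R <= (1 - alpha) * #|S|.-1%:R ->
    m%:R <= (1 - alpha) ^+ i.+1 * #|V|.-1%:R.
  move=> /le_trans; apply; rewrite exprS -mulrA ler_wpM2l//.
  by case/andP: hi.
have /andP[leA leB] : (#|A|.-1%:R <= (1 - alpha) * #|S|.-1%:R)
    && (#|B|.-1%:R <= (1 - alpha) * #|S|.-1%:R).
  by rewrite -ge_max -natr_max maxEnat.
have A0 : (0 < #|A|)%N by rewrite card_gt0; case/andP: cA.
have B0 : (0 < #|B|)%N by rewrite card_gt0; case/andP: cB.
have cardS : #|S| = (#|A| + #|B|)%N.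
  by rewrite -eAB cardsU (disjoint_setI0 dAB) cards0 subn0.
have ltAn : (#|A| < n)%N.
  by rewrite (leq_trans _ (leSn : #|S| <= n)%N)// cardS -addn1 leq_add2l.
have ltBn : (#|B| < n)%N.
  by rewrite (leq_trans _ (leSn : #|S| <= n)%N)// cardS -add1n leq_add2r.
have [l [ul lA cl le_l]] := IHn i.+1 A ltAn cA (le_next _ leA).
have [r [ur rB cr le_r]] := IHn i.+1 B ltBn cB (le_next _ leB).
exists (Node l r); split.
- rewrite /= cat_uniq ul ur andbT /=; apply/hasPn => x; rewrite rB /= lA => xB.
  by rewrite (disjointFl dAB xB).
- by move=> x; rewrite /= mem_cat lA rB -eAB inE.
- rewrite /= all_cat cl cr.
  suff -> : [set x in leaves l ++ leaves r] = S by rewrite cS.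
  by apply/setP=> x; rewrite -eAB !inE mem_cat lA rB.
rewrite -{1}eAB (edge_sum_Node lA rB dAB) eAB.
have lt_iJ : (i < (top_level V alpha).+1)%N by [].
rewrite (big_cat_nat le_ji (ltnW lt_iJ)) (big_ltn lt_iJ) /=.
(* [a] collects the skipped levels, [b] the levels available to both children; the term at [i] pays
   for the split of [S]. *)
set a := \sum_(j <= _ < i) _; set b := \sum_(i.+1 <= _ < _) _.
have a0 : 0 <= a by apply: sumr_ge0 => m _; exact: fine_kappa_ge0.
have b0 : 0 <= b by apply: sumr_ge0 => m _; exact: fine_kappa_ge0.
(* W(S) = W(A) + W(B) + w(A, B) is multiplied by [b] beforehand, so that the remaining inequality is
   linear in the products. *)
have := weight_inU G dAB; rewrite eAB => /(congr1 ( *%R^~ b)); rewrite !mulrDl.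
have := mulr_ge0 (weight_between_ge0 G A B) b0.
have := mulr_ge0 (weight_in_ge0 G S) a0.
by move: le_l le_r le_AB; rewrite -/b; lra.
Qed.

End Construction.

(** * Comparison of the two optima *)

Section Comparison.
Context {R : realType} {V : finType}.
Variable G : wgraph R V.

Lemma connected_hierarchy_height T x y : connected_hierarchy G T ->
  (gdist G x y <= height T x y)%N.
Proof.
case/andP=> hT /allP cT; rewrite /height; case: eqP => [->|_].
  by rewrite gdistxx.
have leT z : z \in leaves T by rewrite (perm_mem hT) mem_enum.
have [lcaT xlca ylca] := lca_cluster_in (leT x) (leT y).
exact: gdist_connected_set (cT _ lcaT) xlca ylca.
Qed.

Lemma OPT_card_le_cost T : connected_hierarchy G T -> OPT_card G <= cost G T.
Proof.
move=> cT; apply: ge_inf.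
  (* The infimum lies below its members only for a set bounded below; costs are nonnegative. *)
  exists 0 => _ [H [_ _ ->]]; apply: edge_sum_ge0 => x y _ _ xy.
  by rewrite mulr_ge0// ltW// weight_gt0.
exists T; split; first by case/andP: cT.
  by move=> x y; apply: connected_hierarchy_height.
(* [height] differs from the cluster size minus one at most on the diagonal, which carries no
   edge. *)
apply: eq_edge_sum => x y _ _ xy; rewrite /height.
by case: eqP xy => // ->; rewrite adj_irr.
Qed.

(** Adjacent vertices are at distance at least 1, so each edge costs at least its weight. *)
Lemma total_weight_lb u : (forall x y, (gdist G x y)%:R <= u x y) ->
  total_weight G <= edge_sum G [set: V] (fun x y => weight G x y * u x y).
Proof.
move=> le_u; apply: ler_edge_sum => x y _ _ xy.
rewrite ler_peMr ?(ltW (weight_gt0 xy))//; apply: le_trans (le_u x y).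
by rewrite ler1n gdist_adj.
Qed.

(* The first case only covers the junk value inf set0 = 0. *)
Lemma OPT_free_bound : OPT_free G = 0 \/ total_weight G <= OPT_free G.
Proof.
rewrite /OPT_free; set E := (X in inf X).
have [->|/set0P E0] := eqVneq E classical_sets.set0; first by left; rewrite inf0.
by right; apply: lb_le_inf => // _ [u [_ le_u ->]]; exact: total_weight_lb.
Qed.

End Comparison.

Theorem theorem9 (R : realType) (V : finType) (G : wgraph R V) (alpha : R)
    (hV : (2 <= #|V|)%N) (hG : connected_graph G)
    (halpha : 0 < alpha <= 1 / 2)
    (hkappa : forall j : nat, (j <= top_level V alpha)%N ->
       (kappa G alpha j < +oo)%E) :
  (exists T : btree V, connected_hierarchy G T /\
     ((cost G T)%:E <=
        (total_weight G)%:E * \sum_(j < (top_level V alpha).+1) kappa G alpha j)%E)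
  /\
  ((OPT_card G / OPT_free G)%:E <=
     \sum_(j < (top_level V alpha).+1) kappa G alpha j)%E.
Proof.
have halpha1 : 0 < alpha < 1 by lra.
set K := \sum_(0 <= j < (top_level V alpha).+1) fine (kappa G alpha j).
have -> : (\sum_(j < (top_level V alpha).+1) kappa G alpha j = K%:E)%E.
  rewrite /K big_mkord -sumEFin; apply: eq_bigr => j _.
  by rewrite fine_kappaK// -ltnS.
have K0 : 0 <= K by apply: sumr_ge0 => j _; exact: fine_kappa_ge0.
have [T [uT leT cT costT]] : exists T, [/\ uniq (leaves T), leaves T =i [set: V],
    all (connected_set G) (clusters T) & cost G T <= total_weight G * K].
  (* The whole vertex set is taken at level 0, where q^0 N = N. *)
  apply: (exists_connected_tree halpha1 hkappa hG).
  by rewrite expr0 mul1r cardsT.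
have hT : connected_hierarchy G T.
  rewrite /connected_hierarchy cT andbT; apply: uniq_perm => //.
    exact: enum_uniq.
  by move=> x; rewrite leT mem_enum !inE.
split; first by exists T.
(* If [OPT_free] is 0, here or in the next case split, the quotient is 0 by convention and [K0]
   suffices. *)
rewrite lee_fin; have [->|le_W] := OPT_free_bound G; first by rewrite invr0 mulr0.
have := le_trans (weight_in_ge0 G [set: V]) le_W.
rewrite le0r => /predU1P[->|free0]; first by rewrite invr0 mulr0.
rewrite ler_pdivrMr// (le_trans (OPT_card_le_cost hT))// (le_trans costT)//.
by rewrite mulrC ler_wpM2l.
Qed.
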